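(* Let $\mathcal{F}$ be a basis of $\mathbb{Q}_p^2$ and let $$\mathscr{A}'=\begin{pmatrix} c & d\\ e & f\end{pmatrix}_a,\qquad \mathscr{A}''=\begin{pmatrix} r & s\\ t & u\end{pmatrix}_a$$ be any pair of apartments in $\mathscr{B}(\mathrm{SL}_2(\mathbb{Q}_p))$, represented with respect to $\mathcal{F}$ by two matrices in $\mathrm{GL}_2(\mathbb{Q}_p)$. Then the number of edges shared by $\mathscr{A}'$ and $\mathscr{A}''$ is equal to $$\left|\ \begin{vmatrix} c & d\\ r & s\end{vmatrix}_p-\begin{vmatrix} c & d\\ t & u\end{vmatrix}_p+\begin{vmatrix} e & f\\ t & u\end{vmatrix}_p-\begin{vmatrix} e & f\\ r & s\end{vmatrix}_p\ \right| ,$$ where the outer bars denote the ordinary absolute value.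
   Context: $p$ is a fixed prime. $\nu:\mathbb{Q}_p\to\mathbb{Z}\cup\{\infty\}$ is the $p$-adic valuation with $\nu(p)=1$, $\nu(0)=\infty$. For a $2\times 2$ matrix $X$ over $\mathbb{Q}_p$, $|X|_p:=\nu(\det X)\in\mathbb{Z}\cup\{\infty\}$; in the claim $\begin{vmatrix} x & y\\ z & w\end{vmatrix}_p$ means $\nu(xw-yz)$. The usual conventions for sums with $\pm\infty$ apply, $|\pm\infty|=\infty$, and the value $\infty$ means that infinitely many edges are shared. Building. A $\mathbb{Z}_p$-lattice in $\mathbb{Q}_p^2$ is a finitely generated $\mathbb{Z}_p$-submodule spanning $\mathbb{Q}_p^2$ over $\mathbb{Q}_p$; $\mathcal{L},\mathcal{L}'$ are homothetic if $\mathcal{L}'=a\mathcal{L}$ for some $a\in\mathbb{Q}_p^\times$. The building $\mathscr{B}(\mathrm{SL}_2(\mathbb{Q}_p))$ is the graph whose vertices are the homothety classes of $\mathbb{Z}_p$-lattices in $\mathbb{Q}_p^2$ and whose edges are the pairs $\{[\mathcal{L}_0],[\mathcal{L}_1]\}$ with lattices $\mathcal{L}_0\supsetneq\mathcal{L}_1\supsetneq p\mathcal{L}_0$. Apartments. For a basis $\{w_1,w_2\}$ of $\mathbb{Q}_p^2$, the corresponding apartment is the subcomplex generated by the vertices given by the lattices $\mathbb{Z}_p[p^{e_1}w_1,p^{e_2}w_2]$ (the $\mathbb{Z}_p$-span), $e_1,e_2\in\mathbb{Z}$. Given a basis $\mathcal{F}=\{u_1,u_2\}$ of $\mathbb{Q}_p^2$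 and $A\in\mathrm{GL}_2(\mathbb{Q}_p)$, $A_a=A_{a:\mathcal{F}}$ denotes the apartment of the basis $w_i=A_{i,1}u_1+A_{i,2}u_2$, $i=1,2$. *)

(* Defs.v *)
From HB Require Import structures.
From mathcomp Require Import all_boot all_order all_algebra.
From mathcomp Require Import finmap boolp classical_sets functions cardinality.
From mathcomp Require Import constructive_ereal.

Set Implicit Arguments.
Unset Strict Implicit.
Unset Printing Implicit Defensive.

Import Order.TTheory GRing.Theory Num.Theory.
Local Open Scope classical_set_scope.
Local Open Scope ring_scope.

(* Z_p is the inverse limit of the rings Z / p^(n+1), n : nat.  The exponents
   start at 1 because 'Z_1 is not the trivial ring in the library.  The
   primality proof is a parameter of the type because the ring structures
   below depend on it. *)
Record padic_int (p : nat) (p_pr : prime p) := PadicInt {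
  residue :> forall n : nat, 'Z_(p ^ n.+1);
  _ : `[< forall n, (residue n.+1 : nat)%:R = residue n >]
}.

Section PadicIntRing.
Variables (p : nat) (p_pr : prime p).
Local Notation Zp := (padic_int p_pr).

HB.instance Definition _ := [isSub for @residue p p_pr].
HB.instance Definition _ := [Choice of Zp by <:].

Lemma pexp_gt1 n : (1 < p ^ n.+1)%N.
Proof. by rewrite -{1}(exp1n n.+1) ltn_exp2r// prime_gt1. Qed.

Lemma residueS (x : Zp) n : (x n.+1 : nat)%:R = x n.
Proof. by case: x => f /= /asboolP. Qed.

Lemma padic_int_ext (x y : Zp) : (forall n, x n = y n) -> x = y.
Proof. by move=> xy; apply: val_inj; apply: functional_extensionality_dep. Qed.

Definition reduce n (a : 'Z_(p ^ n.+2)) : 'Z_(p ^ n.+1) := (a : nat)%:R.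

Lemma reduce_mod n k : ((k %% p ^ n.+2)%N)%:R = k%:R :> 'Z_(p ^ n.+1).
Proof.
apply: ord_inj; rewrite !val_Zp_nat ?pexp_gt1// modn_dvdm//.
by rewrite dvdn_exp2l.
Qed.

Lemma reduceD n : {morph @reduce n : a b / a + b}.
Proof.
move=> a b; rewrite /reduce /= -natrD.
by rewrite [X in (_ %% X)%N]Zp_cast ?pexp_gt1// reduce_mod.
Qed.

Lemma reduceM n : {morph @reduce n : a b / a * b}.
Proof.
move=> a b; rewrite /reduce /= -natrM.
by rewrite [X in (_ %% X)%N]Zp_cast ?pexp_gt1// reduce_mod.
Qed.

Lemma reduce0 n : @reduce n 0 = 0. Proof. by []. Qed.

Lemma reduce1 n : @reduce n 1 = 1.
Proof. by []. Qed.

Lemma reduceN n : {morph @reduce n : a / - a}.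
Proof.
by move=> a; apply/eqP; rewrite -addr_eq0 -reduceD addNr reduce0.
Qed.

Fact coherent0 : `[< forall n, @reduce n 0 = 0 >].
Proof. exact/asboolP. Qed.
Fact coherent1 : `[< forall n, @reduce n 1 = 1 >].
Proof. exact/asboolP. Qed.
Fact coherentD (x y : Zp) :
  `[< forall n, reduce (x n.+1 + y n.+1) = x n + y n >].
Proof. by apply/asboolP => n; rewrite reduceD /reduce !residueS. Qed.
Fact coherentN (x : Zp) : `[< forall n, reduce (- x n.+1) = - x n >].
Proof. by apply/asboolP => n; rewrite reduceN /reduce !residueS. Qed.
Fact coherentM (x y : Zp) :
  `[< forall n, reduce (x n.+1 * y n.+1) = x n * y n >].
Proof. by apply/asboolP => n; rewrite reduceM /reduce !residueS. Qed.

Definition padic_int0 : Zp := PadicInt p_pr coherent0.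
Definition padic_int1 : Zp := PadicInt p_pr coherent1.
Definition padic_intD (x y : Zp) : Zp := PadicInt p_pr (coherentD x y).
Definition padic_intN (x : Zp) : Zp := PadicInt p_pr (coherentN x).
Definition padic_intM (x y : Zp) : Zp := PadicInt p_pr (coherentM x y).

Fact padic_intDA : associative padic_intD.
Proof. by move=> x y z; apply: padic_int_ext => n; apply: addrA. Qed.
Fact padic_intDC : commutative padic_intD.
Proof. by move=> x y; apply: padic_int_ext => n; apply: addrC. Qed.
Fact padic_int0D : left_id padic_int0 padic_intD.
Proof. by move=> x; apply: padic_int_ext => n; apply: add0r. Qed.
Fact padic_intND : left_inverse padic_int0 padic_intN padic_intD.
Proof. by move=> x; apply: padic_int_ext => n; apply: addNr. Qed.
HB.instance Definition _ :=
  GRing.isZmodule.Build Zp padic_intDA padic_intDC padic_int0D padic_intND.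

Fact padic_intMA : associative padic_intM.
Proof. by move=> x y z; apply: padic_int_ext => n; apply: mulrA. Qed.
Fact padic_intMC : commutative padic_intM.
Proof. by move=> x y; apply: padic_int_ext => n; apply: mulrC. Qed.
Fact padic_int1M : left_id padic_int1 padic_intM.
Proof. by move=> x; apply: padic_int_ext => n; apply: mul1r. Qed.
Fact padic_intMD : left_distributive padic_intM padic_intD.
Proof. by move=> x y z; apply: padic_int_ext => n; apply: mulrDl. Qed.
Fact padic_int1_neq0 : padic_int1 != 0.
Proof. by apply/eqP => /(congr1 (fun x : Zp => x 0%N : nat)). Qed.
HB.instance Definition _ := GRing.Zmodule_isComNzRing.Build Zp
  padic_intMA padic_intMC padic_int1M padic_intMD padic_int1_neq0.

Definition padic_int_unit : pred Zp := fun x => `[< exists y, y * x = 1 >].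
Definition padic_int_inv (x : Zp) : Zp :=
  if pselect (exists y, y * x = 1) is left h then sval (cid h) else x.
Fact padic_int_mulVx : {in padic_int_unit, left_inverse 1 padic_int_inv *%R}.
Proof.
move=> x /asboolP ux; rewrite /padic_int_inv.
by case: pselect => // h; exact: (svalP (cid h)).
Qed.
Fact padic_int_unitPl (x y : Zp) : y * x = 1 -> padic_int_unit x.
Proof. by move=> yx; apply/asboolP; exists y. Qed.
Fact padic_int_inv_out : {in [predC padic_int_unit], padic_int_inv =1 id}.
Proof.
move=> x /negP ux; rewrite /padic_int_inv; case: pselect => // h.
by case: ux; apply/asboolP.
Qed.
HB.instance Definition _ := GRing.ComNzRing_hasMulInverse.Build Zp
  padic_int_mulVx padic_int_unitPl padic_int_inv_out.

Lemma residue_exists (x : Zp) : x != 0 -> exists n, x n != 0.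
Proof.
move=> /eqP x0; apply: contrapT => /forallNP h; apply: x0.
by apply: padic_int_ext => n; apply/eqP/negPn/negP/h.
Qed.

(* The p-adic order of a p-adic integer: x n is the class of x modulo p^(n+1),
   so the least n with x n != 0 is the exponent of p in x.  The value at 0 is
   irrelevant. *)
Definition padic_ord (x : Zp) : nat :=
  if pselect (exists n, x n != 0) is left h then ex_minn h else 0%N.

Lemma residue_modn (x : Zp) m n : (m <= n)%N ->
  (x n %% p ^ m.+1)%N = x m :> nat.
Proof.
elim: n m => [|n IHn] m; first by rewrite leqn0 => /eqP ->;
  rewrite modn_small// -[X in (_ < X)%N]Zp_cast ?pexp_gt1.
rewrite leq_eqVlt => /predU1P[->|].
  by rewrite modn_small// -[X in (_ < X)%N]Zp_cast ?pexp_gt1.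
rewrite ltnS => mn; rewrite -(IHn _ mn) -(residueS x n) val_Zp_nat ?pexp_gt1//.
by rewrite modn_dvdm// dvdn_exp2l.
Qed.

Lemma padic_ordP (x : Zp) n : x != 0 -> (padic_ord x <= n)%N ->
  [/\ (0 < x n)%N & logn p (x n) = padic_ord x].
Proof.
move=> x0; rewrite /padic_ord; case: pselect => [h|]; last first.
  by case; exact: residue_exists.
case: ex_minnP => m xm mmin mn.
have xm0 : (0 < x m)%N by rewrite lt0n; apply: contraNN xm => /eqP e; apply/eqP/val_inj.
have xn0 : (0 < x n)%N.
  by rewrite lt0n; apply: contraTneq xm0 => e; rewrite -(residue_modn x mn) e mod0n.
split=> //; apply/eqP; rewrite eqn_leq; apply/andP; split.
  rewrite leqNgt; apply/negP => lt; move: xm0.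
  rewrite -(residue_modn x mn); have /eqP -> // : (p ^ m.+1 %| x n)%N.
  by rewrite pfactor_dvdn.
rewrite -pfactor_dvdn//; case: m {xm xm0} mmin mn => // m mmin mn.
rewrite /dvdn (residue_modn x (ltnW mn)); apply/eqP; apply/eqP.
have [//|xm] := eqVneq (x m) 0; last by have := mmin _ xm; rewrite ltnn.
by move=> ->.
Qed.

Lemma padic_intM_neq0_ord (x y : Zp) : x != 0 -> y != 0 ->
  x * y != 0 /\ padic_ord (x * y) = (padic_ord x + padic_ord y)%N.
Proof.
move=> x0 y0.
have valM n : ((x * y)%R n : nat) = (x n * y n %% p ^ n.+1)%N.
  by rewrite /= [X in (_ %% X)%N]Zp_cast ?pexp_gt1.
set k := (padic_ord x + padic_ord y)%N.
have [xk lx] := padic_ordP x0 (leq_addr (padic_ord y) _ : (_ <= k)%N).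
have [yk ly] := padic_ordP y0 (leq_addl (padic_ord x) _ : (_ <= k)%N).
have lxy : logn p (x k * y k) = k by rewrite lognM// lx ly.
have xyk : (x * y) k != 0.
  apply/eqP => /(congr1 (@nat_of_ord _)); rewrite valM => /eqP.
  by rewrite -/(dvdn _ _) pfactor_dvdn ?muln_gt0 ?xk// lxy ltnn.
have xy0 : x * y != 0 by apply: contraNneq xyk => ->.
split=> //; have le_k : (padic_ord (x * y)%R <= k)%N.
  by rewrite /padic_ord; case: pselect => // h; case: ex_minnP => m _; apply.
have [xyk0 <-] := padic_ordP xy0 le_k; apply/eqP.
rewrite eqn_leq; apply/andP; split.
  rewrite leqNgt; apply/negP; rewrite -pfactor_dvdn// => d.
  move: d; rewrite valM /dvdn modn_mod -/(dvdn _ _).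
  by rewrite pfactor_dvdn ?muln_gt0 ?xk// lxy ltnn.
rewrite -pfactor_dvdn// valM /dvdn modn_dvdm ?dvdn_exp2l// -/(dvdn _ _).
by rewrite pfactor_dvdn ?muln_gt0 ?xk// lxy.
Qed.

Fact padic_int_mulf_eq0 (x y : Zp) : x * y = 0 -> (x == 0) || (y == 0).
Proof.
move=> xy; have [//|x0] := eqVneq x 0; have [//|y0] := eqVneq y 0.
by have [] := padic_intM_neq0_ord x0 y0; rewrite xy eqxx.
Qed.
HB.instance Definition _ :=
  GRing.ComUnitRing_isIntegral.Build Zp padic_int_mulf_eq0.

Lemma padic_ordM (x y : Zp) : x != 0 -> y != 0 ->
  padic_ord (x * y) = (padic_ord x + padic_ord y)%N.
Proof. by move=> x0 y0; have [] := padic_intM_neq0_ord x0 y0. Qed.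

Lemma padic_int_natE (k n : nat) : (k%:R : Zp) n = k%:R.
Proof. by elim: k => // k IHk; rewrite !mulrS -IHk. Qed.

Lemma padic_int_p_neq0 : (p%:R : Zp) != 0.
Proof.
apply/eqP => /(congr1 (fun x : Zp => x 1%N : nat)).
rewrite padic_int_natE val_Zp_nat ?pexp_gt1// modn_small.
  by move=> e; move: p_pr; rewrite e.
by rewrite -{1}(expn1 p) ltn_exp2l// prime_gt1.
Qed.

Lemma padic_ord_p : padic_ord (p%:R : Zp) = 1%N.
Proof.
rewrite /padic_ord; case: pselect => [h|]; last first.
  by case; exact: residue_exists padic_int_p_neq0.
have val_p n : ((p%:R : Zp) n : nat) = (p %% p ^ n.+1)%N.
  by rewrite padic_int_natE val_Zp_nat ?pexp_gt1.
case: ex_minnP => -[|[|m]] hm hmin //.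
  case/eqP: hm; apply: ord_inj.
  by change ((p%:R : Zp) 0%N = 0%N :> nat); rewrite val_p expn1 modnn.
suff /hmin : (p%:R : Zp) 1%N != 0 by [].
apply/eqP => /(congr1 (@nat_of_ord _)); rewrite val_p modn_small.
  by move=> e; move: p_pr; rewrite e.
by rewrite -{1}(expn1 p) ltn_exp2l// prime_gt1.
Qed.

End PadicIntRing.

Local Notation tofrac := (@FracField.tofrac _).
Local Notation "x %:F" := (tofrac x).

Notation padic_num p_pr := {fraction (padic_int p_pr)}.

Section PadicVal.
Local Open Scope quotient_scope.
Variables (p : nat) (p_pr : prime p).
Local Notation Zp := (padic_int p_pr).
Local Notation Qp := (padic_num p_pr).

(* The order of the numerator minus that of the denominator; padic_val_frac
   shows that this does not depend on the representative of the fraction. *)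
Definition padic_val (x : Qp) : \bar int :=
  if x == 0 then +oo%E
  else ((padic_ord (frac (repr x)).1)%:Z - (padic_ord (frac (repr x)).2)%:Z)%:E.

Lemma padic_num_repr (x : Qp) :
  x = (frac (repr x)).1%:F / (frac (repr x)).2%:F.
Proof.
have d0 : (frac (repr x)).2 != 0 by apply: denom_ratioP.
apply: (canRL (mulfK _)); first by rewrite tofrac_eq0.
rewrite -{1}[x]reprK; unlock FracField.tofrac; rewrite -[LHS]FracField.pi_mul.
apply/eqmodP; rewrite /= FracField.equivfE /FracField.mulf.
by rewrite !numden_Ratio ?mulf_neq0 ?oner_neq0// !mulr1 mulrC.
Qed.

Lemma padic_val0 : padic_val 0 = +oo%E. Proof. by rewrite /padic_val eqxx. Qed.

Lemma padic_val_frac (a b : Zp) : a != 0 -> b != 0 ->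
  padic_val (a%:F / b%:F) = ((padic_ord a)%:Z - (padic_ord b)%:Z)%:E.
Proof.
move=> a0 b0; have x0 : a%:F / b%:F != 0 :> Qp.
  by rewrite mulf_neq0 ?invr_eq0 ?tofrac_eq0.
rewrite /padic_val (negPf x0); set x := a%:F / b%:F in x0 *.
have d0 : (frac (repr x)).2 != 0 by apply: denom_ratioP.
have e : a * (frac (repr x)).2 = (frac (repr x)).1 * b.
  apply/eqP; rewrite -tofrac_eq !tofracM -eqr_div ?tofrac_eq0//.
  by rewrite -padic_num_repr.
have n0 : (frac (repr x)).1 != 0.
  by apply: contraNneq x0 => n0; rewrite [x]padic_num_repr n0 tofrac0 mul0r.
congr (_%:E); move/(congr1 (@padic_ord _ _)): e; rewrite !padic_ordM// => e.
by apply/eqP; rewrite subr_eq addrAC eq_sym subr_eq -!PoszD e.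
Qed.

Lemma padic_valM (x y : Qp) : padic_val (x * y) = (padic_val x + padic_val y)%E.
Proof.
have [->|x0] := eqVneq x 0; first by rewrite mul0r padic_val0 /padic_val; case: ifP.
have [->|y0] := eqVneq y 0; first by rewrite mulr0 padic_val0 /padic_val; case: ifP.
have frac_nz z : z != 0 :> Qp ->
    exists a b : Zp, [/\ a != 0, b != 0 & z = a%:F / b%:F].
  move=> z0; exists (frac (repr z)).1, (frac (repr z)).2.
  split; [|exact: denom_ratioP|exact: padic_num_repr].
  by apply: contraNneq z0 => n0; rewrite [z]padic_num_repr n0 tofrac0 mul0r.
have [a [b [a0 b0 ->]]] := frac_nz _ x0.
have [c [d [c0 d0 ->]]] := frac_nz _ y0.
have ac0 : a * c != 0 by rewrite mulf_eq0 negb_or a0.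
have bd0 : b * d != 0 by rewrite mulf_eq0 negb_or b0.
rewrite mulf_div -!tofracM (padic_val_frac ac0 bd0) (padic_val_frac a0 b0).
rewrite (padic_val_frac c0 d0) (padic_ordM a0 c0) (padic_ordM b0 d0) -EFinD !PoszD.
by congr (_%:E); rewrite opprD addrACA.
Qed.

Lemma padic_val_p : padic_val p%:R = 1%:E.
Proof.
have p0 := padic_int_p_neq0 p_pr.
rewrite -[p%:R](divr1 _) -[p%:R](rmorph_nat (@FracField.tofrac Zp)) -[X in _ / X]tofrac1.
rewrite padic_val_frac ?oner_neq0// padic_ord_p; congr (_%:E).
suff -> : padic_ord (1 : Zp) = 0%N by [].
have := padic_ordM (oner_neq0 Zp) (oner_neq0 Zp); rewrite mulr1.
by move/eqP; rewrite -{1}[padic_ord 1]addn0 eqn_add2l eq_sym => /eqP.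
Qed.

End PadicVal.

Section Building.
Variables (p : nat) (p_pr : prime p).
Local Notation Qp := (padic_num p_pr).
Local Notation V := 'rV[Qp]_2.

(* {c_1 s_1 + ... + c_k s_k | c_i in Z_p}; these sets are exactly the finitely
   generated Z_p-submodules of Q_p^2. *)
Definition padic_int_span (s : seq V) : set V :=
  [set v | exists c : 'I_(size s) -> padic_int p_pr,
             v = \sum_(i < size s) (c i)%:F *: s`_i].

Definition is_lattice (L : set V) : Prop :=
  (exists s : seq V, L = padic_int_span s) /\
  (forall v : V, exists2 X : seq V, {in X, forall w, L w} & v \in <<X>>%VS).

Definition dilate (a : Qp) (L : set V) : set V := [set a *: v | v in L].

Definition homothety_class (L : set V) : set (set V) :=
  [set L' | exists2 a : Qp, a != 0 & L' = dilate a L].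

End Building.

(* An edge is the set of its two endpoints. *)
Record graph (T : Type) := Graph {
  vertices : set T;
  edges : set (set T)
}.

(* The full subgraph: an edge belongs to it as soon as its endpoints do. *)
Definition generated_subcomplex (T : Type) (G : graph T) (W : set T) : graph T :=
  Graph (vertices G `&` W) [set E | edges G E /\ E `<=` W].

(* The number of elements of A, +oo when A is infinite. *)
Definition ecard (T : choiceType) (A : set T) : \bar int :=
  if pselect (finite_set A) then (#|` fset_set A|%:Z)%:E else +oo%E.

Section Apartments.
Variables (p : nat) (p_pr : prime p).
Local Notation Qp := (padic_num p_pr).
Local Notation V := 'rV[Qp]_2.

Definition building : graph (set (set V)) := Graph
  [set homothety_class L | L in @is_lattice p p_pr]
  [set E | exists L0 L1 : set V,
     [/\ is_lattice L0, is_lattice L1, L1 `<` L0, dilate p%:R L0 `<` L1 &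
         E = [set homothety_class L0; homothety_class L1]]].

Definition apartment (w1 w2 : V) : graph (set (set V)) :=
  generated_subcomplex building
    [set x | exists e1 e2 : int,
       x = homothety_class
             (padic_int_span [:: (p%:R : Qp) ^ e1 *: w1; (p%:R : Qp) ^ e2 *: w2])].

(* The rows of A are the coordinates in F of the basis of the apartment. *)
Definition mx_apartment (F : 2.-tuple V) (A : 'M[Qp]_2) : graph (set (set V)) :=
  let w i := A i 0 *: tnth F 0 + A i 1 *: tnth F 1 in apartment (w 0) (w 1).

Definition mx2 (a b c d : Qp) : 'M[Qp]_2 :=
  \matrix_(i, j) if i == 0 then (if j == 0 then a else b)
                 else (if j == 0 then c else d).

Definition det_val (X : 'M[Qp]_2) : \bar int := padic_val (\det X).

End Apartments.

(* Main.v *)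
Require Import Defs.
From mathcomp Require Import all_boot all_order all_algebra.
From mathcomp Require Import classical_sets constructive_ereal.
From mathcomp Require Import finmap boolp functions cardinality zify ring.
Local Open Scope classical_set_scope.
Local Open Scope ring_scope.

Set Implicit Arguments.
Unset Strict Implicit.
Unset Printing Implicit Defensive.

Import Order.TTheory GRing.Theory Num.Theory.

(** Write [w1, w2] and [x1, x2] for the bases of the two apartments, and
    [D = cf - de], [E = ru - st] for the determinants of their matrices.  The
    four minors
      [P = cs - dr],  [Q = cu - dt],  [R = eu - ft],  [S = es - fr]
    are, up to sign and the factors [D] and [E], the entries of the two
    transition matrices (Cramer's rule), and they satisfy [PR - QS = DE].

    An apartment is a line.  Its vertices are the classes of the lattices
    [Z_p w1 + p^n Z_p w2], one for each integer [n], and its edges join [n] to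
    [n + 1] ([edges_apartment]).  Hence the shared edges are the pairs
    [n, n + 1] of consecutive vertices of the first line that both lie on the
    second one ([shared_edges]).

    Up to a unit, a homothety is a dilation by a power of [p].  So the vertex
    [n] of the first line is the vertex [m] of the second one exactly when,
    for some integer [k], each of the lattices
      [p^k Z_p w1 + p^(k+n) Z_p w2]  and  [Z_p x1 + p^m Z_p x2]
    contains the generators of the other.  Since [Z_p] is the set of p-adic
    numbers of nonnegative valuation, this is a system of eight lower bounds
    on the valuations of the minors ([shared_vertexP]).

    By [PR - QS = DE], the least of the integers [v(P) + v(R)],
    [v(Q) + v(S)] and [v(D) + v(E)] is attained twice.  If the four minors are
    nonzero, the system then says that [n] lies between [v(Q) - v(R)] and
    [v(P) - v(S)], in one order or the other according to which of
    [v(P) + v(R)] and [v(Q) + v(S)] is smaller ([shared_interval]); the number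
    of consecutive pairs is the distance between the two bounds.  If a minor
    vanishes, at least one of the bounds disappears: the apartments share a
    half-line, and the formula is infinite as well
    ([shared_index_half_line]). *)

Local Notation "x %:F" := (@FracField.tofrac _ x).

(** * The valuation of the p-adic numbers *)

Section PadicNumbers.
Variables (p : nat) (p_pr : prime p).
Local Notation Zp := (padic_int p_pr).
Local Notation Qp := (padic_num p_pr).

(** The quotient of [x] by [p] is obtained by dividing the residue modulo
    [p ^ n.+2] to get one modulo [p ^ n.+1]. *)
Lemma padic_int_dvdp (x : Zp) : x 0%N = 0 -> exists y : Zp, x = p%:R * y.
Proof.
move=> x0; have p_gt0 := prime_gt0 p_pr.
pose y n : 'Z_(p ^ n.+1) := ((x n.+1 : nat) %/ p)%:R.
have yP : `[< forall n, (y n.+1 : nat)%:R = y n >].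
  apply/asboolP => n; rewrite /y val_Zp_nat ?pexp_gt1// (reduce_mod p_pr).
  apply: ord_inj; rewrite !val_Zp_nat ?pexp_gt1//.
  rewrite -(residue_modn x (leqnSn n.+1)) divn_modl ?dvdn_exp//.
  by rewrite (expnS p n.+1) mulKn// modn_mod.
exists (PadicInt p_pr yP); apply: padic_int_ext => n.
rewrite -[LHS](residueS x).
change ((x n.+1 : nat)%:R = (p%:R : Zp) n * y n).
rewrite padic_int_natE /y -natrM mulnC divnK//.
by rewrite /dvdn -[X in (_ %% X)%N]expn1 residue_modn// x0.
Qed.

Lemma padic_int_unit0 (x : Zp) : x 0%N != 0 -> x \is a GRing.unit.
Proof.
move=> x0.
have xn n : x n \is a GRing.unit.
  rewrite -[x n]natr_Zp unitZpE ?pexp_gt1// coprime_pexpl// prime_coprime//.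
  by rewrite -[X in (X %| _)%N]expn1 /dvdn residue_modn//.
have yP : `[< forall n, ((x n.+1)^-1 : nat)%:R = (x n)^-1 >].
  apply/asboolP => n; apply: (mulIr (xn n)); rewrite (mulVr (xn n)).
  rewrite -(residueS x n); change (reduce (x n.+1)^-1 * reduce (x n.+1) = 1).
  by rewrite -(reduceM p_pr) (mulVr (xn n.+1)) reduce1.
apply/unitrP; exists (PadicInt p_pr yP).
suff e : (PadicInt p_pr yP : Zp) * x = 1 by split; rewrite // mulrC.
by apply: padic_int_ext => n; exact: mulVr (xn n).
Qed.

Lemma padic_ord_unit (u : Zp) : u \is a GRing.unit -> padic_ord u = 0%N.
Proof.
move=> uU; have u0 : u != 0 by apply: contraTneq uU => ->; rewrite unitr0.
have := padic_ordM u0 (invr_neq0 u0 : u^-1 != 0); rewrite divrr//.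
have := padic_ordM (oner_neq0 Zp) (oner_neq0 Zp); rewrite mulr1.
by move: (padic_ord 1) (padic_ord u) (padic_ord u^-1) => a b c; lia.
Qed.

Lemma padic_int_factor (x : Zp) : x != 0 ->
  exists2 u : Zp, u \is a GRing.unit & x = p%:R ^+ padic_ord x * u.
Proof.
have [k] := ubnP (padic_ord x); elim: k x => // k IHk x ordx x0.
have [/padic_int_dvdp[y xy]|/padic_int_unit0 xU] := eqVneq (x 0%N) 0; last first.
  by exists x => //; rewrite padic_ord_unit// mul1r.
have y0 : y != 0 by apply: contraNneq x0 => y0; rewrite xy y0 mulr0.
have ordxy : padic_ord x = (padic_ord y).+1.
  by rewrite xy padic_ordM ?padic_int_p_neq0// padic_ord_p.
have [|u uU yu] := IHk y _ y0; first by rewrite -ordxy.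
by exists u => //; rewrite ordxy exprS -mulrA -yu.
Qed.

(** The valuation of a nonzero p-adic number, as an integer; its value at 0
    is 0. *)
Definition valz (x : Qp) : int := fine (padic_val x).

Local Notation pQ := (p%:R : Qp).

Lemma pQ_neq0 : pQ != 0.
Proof.
by rewrite -(rmorph_nat (@FracField.tofrac Zp)) tofrac_eq0 padic_int_p_neq0.
Qed.

Lemma valz_frac (a b : Zp) : a != 0 -> b != 0 ->
  valz (a%:F / b%:F) = (padic_ord a)%:Z - (padic_ord b)%:Z.
Proof. by move=> a0 b0; rewrite /valz padic_val_frac. Qed.

Lemma valz_int (a : Zp) : a != 0 -> valz a%:F = padic_ord a.
Proof.
move=> a0; rewrite -[a%:F]divr1 -tofrac1 valz_frac ?oner_neq0//.
by rewrite (padic_ord_unit (unitr1 _)) subr0.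
Qed.

Lemma padic_num_frac (x : Qp) : x != 0 ->
  exists a b : Zp, [/\ a != 0, b != 0 & x = a%:F / b%:F].
Proof.
move=> x0; exists (frac (repr x)).1, (frac (repr x)).2.
split; [|exact: denom_ratioP|exact: padic_num_repr].
by apply: contraNneq x0 => n0; rewrite [x]padic_num_repr n0 tofrac0 mul0r.
Qed.

Lemma padic_valE (x : Qp) : x != 0 -> padic_val x = (valz x)%:E.
Proof.
by move=> /padic_num_frac[a [b [a0 b0 ->]]]; rewrite valz_frac// padic_val_frac.
Qed.

Lemma valzM (x y : Qp) : x != 0 -> y != 0 -> valz (x * y) = valz x + valz y.
Proof.
by move=> x0 y0; rewrite {1}/valz padic_valM (padic_valE x0) (padic_valE y0).
Qed.

Lemma valz_p : valz pQ = 1. Proof. by rewrite /valz padic_val_p. Qed.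

Lemma valz1 : valz 1 = 0.
Proof.
have := valzM (oner_neq0 Qp) (oner_neq0 Qp); rewrite mulr1.
by move: (valz 1) => a; lia.
Qed.

Lemma valzV (x : Qp) : valz x^-1 = - valz x.
Proof.
have [->|x0] := eqVneq x 0; first by rewrite invr0 /valz padic_val0.
by have := valzM x0 (invr_neq0 x0); rewrite divff// valz1; lia.
Qed.

Lemma valz_pX (k : int) : valz (pQ ^ k) = k.
Proof.
have vzn (n : nat) : valz (pQ ^+ n) = n.
  elim: n => [|n IHn]; first by rewrite valz1.
  by rewrite exprS (valzM pQ_neq0 (expf_neq0 n pQ_neq0)) IHn valz_p -intS.
by case: k => n; rewrite ?NegzE -?exprnN ?valzV ?vzn.
Qed.

Lemma valzN (x : Qp) : valz (- x) = valz x.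
Proof.
have [->|x0] := eqVneq x 0; first by rewrite oppr0.
have n1 : -1 != 0 :> Qp by rewrite oppr_eq0 oner_neq0.
rewrite -mulN1r (valzM n1 x0); have := valzM n1 n1.
by rewrite mulrNN mulr1 valz1; lia.
Qed.

(** Every nonzero p-adic number is a power of [p] times a unit of [Z_p]. *)
Lemma padic_num_factor (x : Qp) : x != 0 ->
  exists2 u : Zp, u \is a GRing.unit & x = pQ ^ valz x * u%:F.
Proof.
move=> /padic_num_frac[a [b [a0 b0 xab]]].
have [u uU au] := padic_int_factor a0; have [w wU bw] := padic_int_factor b0.
exists (u / w); first by rewrite unitrM unitrV uU.
have w0 : w%:F != 0.
  by rewrite tofrac_eq0; apply: contraTneq wU => ->; rewrite unitr0.
have wV : (w^-1)%:F = w%:F^-1.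
  by apply: (mulIf w0); rewrite mulVf// -tofracM mulVr.
rewrite xab valz_frac// {1}au {1}bw !tofracM !tofracXn wV rmorph_nat.
by rewrite expfzDr ?pQ_neq0// -exprnN invfM -!exprnP; ring.
Qed.

(** [val_ge k x] says that the valuation of [x] is at least [k]; zero has
    infinite valuation. *)
Definition val_ge (k : int) (x : Qp) : bool := (x == 0) || (k <= valz x).

(** [Z_p] is the valuation ring of [Q_p]. *)
Lemma val_ge0P (x : Qp) : reflect (exists a : Zp, x = a%:F) (val_ge 0 x).
Proof.
apply: (iffP idP) => [|[a ->]]; rewrite /val_ge.
  have [-> _|x0 /= vx] := eqVneq x 0; first by exists 0; rewrite tofrac0.
  have [u _ ->] := padic_num_factor x0; case: (valz x) vx => // n _.
  by exists (p%:R ^+ n * u); rewrite tofracM tofracXn rmorph_nat.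
by rewrite tofrac_eq0; have [//|a0] := eqVneq a 0; rewrite valz_int.
Qed.

Lemma val_ge_shift (j k : int) (x : Qp) : val_ge k (pQ ^ j * x) = val_ge (k - j) x.
Proof.
have pj : pQ ^ j != 0 by rewrite expfz_neq0 ?pQ_neq0.
rewrite /val_ge mulf_eq0 (negPf pj)/=; have [//|x0/=] := eqVneq x 0.
by rewrite (valzM pj x0) valz_pX lerBlDl.
Qed.

Lemma val_geP (k : int) (x : Qp) :
  reflect (exists a : Zp, x = a%:F * pQ ^ k) (val_ge k x).
Proof.
have pk : pQ ^ k != 0 by rewrite expfz_neq0 ?pQ_neq0.
have -> : val_ge k x = val_ge 0 (pQ ^ (- k) * x).
  by rewrite val_ge_shift opprK add0r.
rewrite -exprz_inv; apply: (iffP (val_ge0P _)) => -[a xa]; exists a.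
  by rewrite -xa exprz_inv -invr_expz mulrAC mulVf// mul1r.
by rewrite xa exprz_inv -invr_expz mulrC mulfK.
Qed.

Lemma val_geD (k : int) (x y : Qp) : val_ge k x -> val_ge k y -> val_ge k (x + y).
Proof.
move=> /val_geP[a ->] /val_geP[b ->]; apply/val_geP; exists (a + b).
by rewrite tofracD mulrDl.
Qed.

Lemma val_geN (k : int) (x : Qp) : val_ge k (- x) = val_ge k x.
Proof. by rewrite /val_ge oppr_eq0 valzN. Qed.

Lemma val_geMr (x y : Qp) k : y != 0 -> val_ge k (x * y) = val_ge (k - valz y) x.
Proof.
move=> y0; rewrite /val_ge mulf_eq0 (negPf y0) orbF.
by have [//|x0/=] := eqVneq x 0; rewrite (valzM x0 y0) lerBlDr.
Qed.

Lemma val_geM j k (x y : Qp) : val_ge j x -> val_ge k y -> val_ge (j + k) (x * y).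
Proof.
rewrite /val_ge mulf_eq0; have [//|x0] := eqVneq x 0; have [//|y0/=] := eqVneq y 0.
by rewrite (valzM x0 y0); exact: lerD.
Qed.

Lemma val_ge_pX (j k : int) : val_ge k (pQ ^ j) = (k <= j).
Proof. by rewrite /val_ge valz_pX expfz_eq0 (negPf pQ_neq0) andbF. Qed.

Lemma val_ge_div k (x y : Qp) : y != 0 -> val_ge k (x / y) = val_ge (k + valz y) x.
Proof. by move=> y0; rewrite val_geMr ?invr_eq0// valzV opprK. Qed.

Lemma val_ge_neq0 k (x : Qp) : x != 0 -> val_ge k x = (k <= valz x).
Proof. by rewrite /val_ge => /negPf ->. Qed.

(** The ultrametric inequality for nonzero numbers. *)
Lemma valz_sub_min (x y z : Qp) : x != 0 -> y != 0 -> z != 0 -> x - y = z ->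
  (valz x <= valz z) || (valz y <= valz z).
Proof.
move=> x0 y0 z0 xyz; rewrite -!(val_ge_neq0 _ z0) -xyz.
have [xy|/ltW yx] := leP (valz x) (valz y); apply/orP; [left|right].
  by apply: val_geD; rewrite ?val_geN val_ge_neq0.
by apply: val_geD; rewrite ?val_geN val_ge_neq0.
Qed.

End PadicNumbers.

(** * Change of basis in a plane *)

Lemma span2_change (K : comNzRingType) (V : lmodType K) (x1 x2 : V)
    (a b c d s t : K) :
  s *: (a *: x1 + b *: x2) + t *: (c *: x1 + d *: x2) =
  (s * a + t * c) *: x1 + (s * b + t * d) *: x2.
Proof. by rewrite !scalerDr !scalerA !scalerDl addrACA. Qed.

Section TwoDimensional.
Variables (K : fieldType) (V : vectType K) (w1 w2 : V).

Lemma mem_span2 v :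
  reflect (exists a b : K, v = a *: w1 + b *: w2) (v \in <<[:: w1; w2]>>%VS).
Proof.
rewrite span_cons span_seq1; apply: (iffP memv_addP).
  by move=> [_ /vlineP[a ->]] [_ /vlineP[b ->] ->]; exists a, b.
move=> [a [b ->]]; exists (a *: w1); first by rewrite memvZ ?memv_line.
by exists (b *: w2) => //; rewrite memvZ ?memv_line.
Qed.

Hypothesis w_basis : basis_of fullv [:: w1; w2].

Lemma basis2_coord v : exists a b : K, v = a *: w1 + b *: w2.
Proof.
by apply/mem_span2; rewrite (eqP (andP w_basis).1) memvf.
Qed.

Lemma basis2_inj a b a' b' :
  a *: w1 + b *: w2 = a' *: w1 + b' *: w2 -> a = a' /\ b = b'.
Proof.
move=> /eqP; rewrite -subr_eq0 opprD addrACA -!scalerBl => /eqP e.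
have /andP[_ /freeP fr] := w_basis.
have := fr [ffun i : 'I_2 => if i == 0 then a - a' else b - b'].
rewrite !big_ord_recl big_ord0 !ffunE/= addr0 => /(_ e) h.
split; apply/eqP; rewrite -subr_eq0.
  by have := h 0; rewrite ffunE/= => ->.
by have := h 1; rewrite ffunE/= => ->.
Qed.

End TwoDimensional.

Lemma basis2_change (K : fieldType) (V : vectType K) (u1 u2 : V) (c d e f : K) :
  basis_of fullv [:: u1; u2] -> c * f - d * e != 0 ->
  basis_of fullv [:: c *: u1 + d *: u2; e *: u1 + f *: u2].
Proof.
move=> u_basis D0; set w1 := c *: u1 + _; set w2 := e *: u1 + _.
rewrite basisEdim /= -(size_basis u_basis) leqnn andbT.
rewrite -(eqP (andP u_basis).1); apply/span_subvP => v; rewrite !inE => /orP[]/eqP->.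
  apply/mem_span2; exists (f / (c * f - d * e)), (- d / (c * f - d * e)).
  rewrite span2_change -[LHS]addr0 -[X in _ + X](scale0r u2) -{1}[u1]scale1r.
  by congr (_ *: _ + _ *: _); field.
apply/mem_span2; exists (- e / (c * f - d * e)), (c / (c * f - d * e)).
rewrite span2_change -[LHS]add0r -[X in X + _](scale0r u1) -{1}[u2]scale1r.
by congr (_ *: _ + _ *: _); field.
Qed.

(** Cramer's rule in a plane, with the denominators cleared. *)
Lemma cramer2 (K : comNzRingType) (V : lmodType K) (u1 u2 : V) (c d e f r s : K) :
  (c * f - d * e) *: (r *: u1 + s *: u2) =
    - (e * s - f * r) *: (c *: u1 + d *: u2) +
    (c * s - d * r) *: (e *: u1 + f *: u2).
Proof.
rewrite span2_change scalerDr !scalerA.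
by congr (_ *: _ + _ *: _); ring.
Qed.

(** [cramer2] with the two bases exchanged and the coefficients rewritten with
    the minors that appear there. *)
Lemma cramer2_dual (K : comNzRingType) (V : lmodType K) (u1 u2 : V) (c d r s t u : K) :
  (r * u - s * t) *: (c *: u1 + d *: u2) =
    (c * u - d * t) *: (r *: u1 + s *: u2) +
    - (c * s - d * r) *: (t *: u1 + u *: u2).
Proof.
rewrite span2_change scalerDr !scalerA.
by congr (_ *: _ + _ *: _); ring.
Qed.

(** The three-term Pluecker relation of four vectors of a plane. *)
Lemma plucker2 (K : comNzRingType) (c d e f r s t u : K) :
  (c * s - d * r) * (e * u - f * t) - (c * u - d * t) * (e * s - f * r) =
  (c * f - d * e) * (r * u - s * t).
Proof. by ring. Qed.

(** * Lattices adapted to a basis *)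

Section Lattices.
Variables (p : nat) (p_pr : prime p).
Local Notation Zp := (padic_int p_pr).
Local Notation Qp := (padic_num p_pr).
Local Notation V := 'rV[Qp]_2.
Local Notation pQ := (p%:R : Qp).
Implicit Types (w x : V) (L : set V).

(** The lattice [p^e1 Z_p w1 + p^e2 Z_p w2]. *)
Definition diag_lattice w1 w2 (e1 e2 : int) : set V :=
  padic_int_span [:: pQ ^ e1 *: w1; pQ ^ e2 *: w2].

Lemma padic_int_span2 x y v :
  padic_int_span [:: x; y] v <-> exists a b : Zp, v = a%:F *: x + b%:F *: y.
Proof.
split=> [[c ->]|[a [b ->]]].
  by exists (c ord0), (c (lift ord0 ord0)); rewrite !big_ord_recl big_ord0 addr0.
exists (fun i => if i == ord0 then a else b).
by rewrite !big_ord_recl big_ord0 addr0.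
Qed.

Section OneBasis.
Variables (w1 w2 : V) (w_basis : basis_of fullv [:: w1; w2]).

Lemma mem_diag_lattice e1 e2 (a b : Qp) :
  diag_lattice w1 w2 e1 e2 (a *: w1 + b *: w2) <-> val_ge e1 a /\ val_ge e2 b.
Proof.
split=> [/padic_int_span2[c [d]]|[/val_geP[c ->] /val_geP[d ->]]].
  by rewrite !scalerA => /(basis2_inj w_basis)[-> ->]; split; apply/val_geP; eexists.
by apply/padic_int_span2; exists c, d; rewrite !scalerA.
Qed.

Lemma dilate_diag_lattice e1 e2 (a : Qp) : a != 0 ->
  dilate a (diag_lattice w1 w2 e1 e2) =
    diag_lattice w1 w2 (e1 + valz a) (e2 + valz a).
Proof.
move=> a0; have vs k b : val_ge (k + valz a) (a * b) = val_ge k b.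
  by rewrite mulrC val_geMr// addrK.
apply/seteqP; split=> v.
  move=> [u + <-]; have [b [c ->]] := basis2_coord w_basis u.
  by rewrite mem_diag_lattice scalerDr !scalerA mem_diag_lattice !vs.
have [b [c ->]] := basis2_coord w_basis v => /mem_diag_lattice h.
exists ((a^-1 * b) *: w1 + (a^-1 * c) *: w2).
  by apply/mem_diag_lattice; rewrite -vs -[val_ge e2 _]vs !mulVKf.
by rewrite scalerDr !scalerA !mulVKf.
Qed.

Lemma diag_lattice_is_lattice e1 e2 : is_lattice (diag_lattice w1 w2 e1 e2).
Proof.
split; first by eexists.
move=> v; exists [:: pQ ^ e1 *: w1; pQ ^ e2 *: w2].
  move=> w; rewrite !inE => /orP[]/eqP->; apply/padic_int_span2.
    by exists 1, 0; rewrite tofrac1 tofrac0 scale1r scale0r addr0.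
  by exists 0, 1; rewrite tofrac1 tofrac0 scale1r scale0r add0r.
have [a [b ->]] := basis2_coord w_basis v; apply/mem_span2.
exists (a * pQ ^ (- e1)), (b * pQ ^ (- e2)).
have pk k (c : Qp) : c * pQ ^ (- k) * pQ ^ k = c.
  by rewrite -mulrA -expfzDr ?pQ_neq0// addNr mulr1.
by rewrite !scalerA !pk.
Qed.

End OneBasis.

(** The inclusion of lattices is a condition on the coordinates in the second
    basis of the vectors of the first one. *)
Lemma diag_lattice_sub w1 w2 x1 x2 (a b c d : Qp) e1 e2 f1 f2 :
    basis_of fullv [:: w1; w2] -> basis_of fullv [:: x1; x2] ->
    w1 = a *: x1 + b *: x2 -> w2 = c *: x1 + d *: x2 ->
  diag_lattice w1 w2 e1 e2 `<=` diag_lattice x1 x2 f1 f2 <->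
  [/\ val_ge (f1 - e1) a, val_ge (f2 - e1) b, val_ge (f1 - e2) c
    & val_ge (f2 - e2) d].
Proof.
move=> w_basis x_basis w1E w2E.
have coordE (s t : Qp) :
    s *: w1 + t *: w2 = (s * a + t * c) *: x1 + (s * b + t * d) *: x2.
  by rewrite w1E w2E span2_change.
split=> [sub|[va vb vc vd] v].
  have : diag_lattice x1 x2 f1 f2 (pQ ^ e1 *: w1 + 0 *: w2).
    by apply/sub/(mem_diag_lattice w_basis); rewrite val_ge_pX /val_ge eqxx.
  have : diag_lattice x1 x2 f1 f2 (0 *: w1 + pQ ^ e2 *: w2).
    by apply/sub/(mem_diag_lattice w_basis); rewrite val_ge_pX /val_ge eqxx.
  rewrite !coordE !mul0r !add0r !addr0 !(mem_diag_lattice x_basis) !val_ge_shift.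
  by move=> [-> ->] [-> ->].
have [s [t ->]] := basis2_coord w_basis v => /(mem_diag_lattice w_basis)[vs vt].
rewrite coordE; apply/(mem_diag_lattice x_basis); split; apply: val_geD.
- by rewrite -[f1](subrK e1) addrC val_geM.
- by rewrite -[f1](subrK e2) addrC val_geM.
- by rewrite -[f2](subrK e1) addrC val_geM.
- by rewrite -[f2](subrK e2) addrC val_geM.
Qed.

(** [diag_lattice_sub] for coordinates with the common denominator [q]. *)
Lemma diag_lattice_sub_frac (w1 w2 x1 x2 : V) (q a b c d : Qp) e1 e2 f1 f2 :
    basis_of fullv [:: w1; w2] -> basis_of fullv [:: x1; x2] -> q != 0 ->
    q *: w1 = a *: x1 + b *: x2 -> q *: w2 = c *: x1 + d *: x2 ->
  diag_lattice w1 w2 e1 e2 `<=` diag_lattice x1 x2 f1 f2 <->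
  [/\ val_ge (f1 - e1 + valz q) a, val_ge (f2 - e1 + valz q) b,
      val_ge (f1 - e2 + valz q) c & val_ge (f2 - e2 + valz q) d].
Proof.
move=> w_basis x_basis q0 w1E w2E.
have divE (w : V) (s t : Qp) : q *: w = s *: x1 + t *: x2 ->
    w = (s / q) *: x1 + (t / q) *: x2.
  move=> /(congr1 (fun v => q^-1 *: v)).
  by rewrite scalerA mulVf// scale1r scalerDr !scalerA ![q^-1 * _]mulrC.
have := diag_lattice_sub e1 e2 f1 f2 w_basis x_basis
  (divE _ _ _ w1E) (divE _ _ _ w2E).
by rewrite !(val_ge_div _ _ q0).
Qed.

Lemma dilate1 L : dilate 1 L = L.
Proof.
rewrite /dilate; under eq_imagel do rewrite scale1r.
exact: image_id.
Qed.

Lemma dilateM (a b : Qp) L : dilate a (dilate b L) = dilate (a * b) L.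
Proof.
apply/seteqP; split=> v.
  by move=> [_ [u Lu <-] <-]; exists u; rewrite // scalerA.
by move=> [u Lu <-]; exists (b *: u); [exists u|rewrite scalerA].
Qed.

Lemma homothety_classP L L' :
  homothety_class L = homothety_class L' <->
  exists2 a : Qp, a != 0 & L' = dilate a L.
Proof.
split=> [LL'|[a a0 ->]].
  have : homothety_class L' L' by exists 1; rewrite ?oner_neq0// dilate1.
  by rewrite -LL'.
apply/seteqP; split=> _ [b b0 ->].
  exists (b / a); first exact: mulf_neq0 b0 (invr_neq0 a0).
  by rewrite dilateM (divfK a0).
exists (b * a); first exact: mulf_neq0 b0 a0.
by rewrite dilateM.
Qed.

(** * Apartments as lines *)

(** The vertex of index [n] of the apartment of [w1, w2]. *)
Definition vertex w1 w2 (n : int) : set (set V) :=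
  homothety_class (diag_lattice w1 w2 0 n).

(** The edge of the apartment of [w1, w2] that joins the vertices of index [n]
    and [n + 1]. *)
Definition line_edge w1 w2 (n : int) : set (set (set V)) :=
  [set vertex w1 w2 n; vertex w1 w2 (n + 1)].

Section OneApartment.
Variables (w1 w2 : V) (w_basis : basis_of fullv [:: w1; w2]).

Let w1E : w1 = 1 *: w1 + 0 *: w2. Proof. by rewrite scale1r scale0r addr0. Qed.
Let w2E : w2 = 0 *: w1 + 1 *: w2. Proof. by rewrite scale1r scale0r add0r. Qed.

Lemma diag_lattice_sub_same e1 e2 f1 f2 :
  diag_lattice w1 w2 e1 e2 `<=` diag_lattice w1 w2 f1 f2 <-> f1 <= e1 /\ f2 <= e2.
Proof.
rewrite (diag_lattice_sub _ _ _ _ w_basis w_basis w1E w2E).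
rewrite /val_ge eqxx oner_eq0 valz1/= !subr_le0.
by split=> [[]|[]].
Qed.

Lemma diag_lattice_inj e1 e2 f1 f2 :
  diag_lattice w1 w2 e1 e2 = diag_lattice w1 w2 f1 f2 -> e1 = f1 /\ e2 = f2.
Proof.
move=> /seteqP[/diag_lattice_sub_same[h1 h2] /diag_lattice_sub_same[h3 h4]].
by split; apply: le_anti; [rewrite h1 h3|rewrite h2 h4].
Qed.

Lemma diag_lattice_proper_same e1 e2 f1 f2 :
  diag_lattice w1 w2 e1 e2 `<` diag_lattice w1 w2 f1 f2 <->
  [/\ f1 <= e1, f2 <= e2 & (f1 < e1) || (f2 < e2)].
Proof.
rewrite properEneq; split=> [[ef /diag_lattice_sub_same[h1 h2]]|[h1 h2 h]].
  split=> //; rewrite !lt_neqAle h1 h2 !andbT -negb_and; apply: contraNN ef.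
  by move=> /andP[/eqP -> /eqP ->].
split; last exact/diag_lattice_sub_same.
by apply/eqP => /diag_lattice_inj[e f]; move: h; rewrite e f !ltxx.
Qed.

Lemma vertex_diag_lattice e1 e2 :
  homothety_class (diag_lattice w1 w2 e1 e2) = vertex w1 w2 (e2 - e1).
Proof.
apply/homothety_classP.
have pe : pQ ^ (- e1) != 0 := expfz_neq0 _ (pQ_neq0 p_pr).
exists (pQ ^ (- e1)); first exact: pe.
by rewrite (dilate_diag_lattice w_basis e1 e2 pe) valz_pX subrr.
Qed.

Lemma vertex_inj : injective (vertex w1 w2).
Proof.
move=> n m /homothety_classP[a a0].
rewrite (dilate_diag_lattice w_basis _ _ a0) => /diag_lattice_inj[].
by rewrite add0r => <-; rewrite addr0.
Qed.

Lemma line_edge_inj : injective (line_edge w1 w2).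
Proof.
move=> n m nm.
have : line_edge w1 w2 m (vertex w1 w2 n) by rewrite -nm; left.
have : line_edge w1 w2 m (vertex w1 w2 (n + 1)) by rewrite -nm; right.
by case=> /vertex_inj h1 [] /vertex_inj h2; lia.
Qed.

(** The set of vertices that generates the apartment of [w1, w2], written as in
    the definition of [apartment]. *)
Definition on_apartment : set (set (set V)) :=
  [set x | exists e1 e2 : int,
     x = homothety_class
           (padic_int_span [:: pQ ^ e1 *: w1; pQ ^ e2 *: w2])].

Lemma on_apartmentE : on_apartment = range (vertex w1 w2).
Proof.
apply/seteqP; split=> v.
  by move=> [e1 [e2 ->]]; exists (e2 - e1); [|exact/esym/vertex_diag_lattice].
by move=> [n _ <-]; exists 0, n; reflexivity.
Qed.

Lemma building_line_edge n : edges (building p_pr) (line_edge w1 w2 n).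
Proof.
exists (diag_lattice w1 w2 0 n), (diag_lattice w1 w2 0 (n + 1)); split=> //.
- exact: diag_lattice_is_lattice.
- exact: diag_lattice_is_lattice.
- by apply/diag_lattice_proper_same; split; lia.
- rewrite (dilate_diag_lattice w_basis _ _ (pQ_neq0 p_pr)) valz_p.
  by apply/diag_lattice_proper_same; split; lia.
Qed.

Lemma edges_apartment : edges (apartment w1 w2) = range (line_edge w1 w2).
Proof.
rewrite /apartment /= -/on_apartment; apply/seteqP; split=> E; last first.
  move=> [n _ <-]; split; first exact: building_line_edge.
  by rewrite on_apartmentE => v [->|->]; [exists n|exists (n + 1)].
move=> [[L0 [L1 [_ _ L10 pL01 ->]]] sub].
have latE L : on_apartment (homothety_class L) ->
    exists e1 e2, L = diag_lattice w1 w2 e1 e2.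
  move=> [e1 [e2 /esym/homothety_classP[a a0 ->]]].
  rewrite -/(diag_lattice _ _ _ _) (dilate_diag_lattice w_basis _ _ a0).
  by eexists; eexists.
have [e1 [e2 L0E]] := latE _ (sub _ (or_introl erefl)).
have [f1 [f2 L1E]] := latE _ (sub _ (or_intror erefl)).
move: L10 pL01; rewrite L0E L1E.
rewrite (dilate_diag_lattice w_basis _ _ (pQ_neq0 p_pr)) valz_p.
move=> /diag_lattice_proper_same[h1 h2 h3] /diag_lattice_proper_same[h4 h5 h6].
rewrite !vertex_diag_lattice.
(* Each exponent grows by 0 or 1 from [L0] to [L1], and exactly one of them
   does grow because both inclusions are strict. *)
have [ef|ef] : f2 - f1 = e2 - e1 + 1 \/ e2 - e1 = f2 - f1 + 1 by lia.
  by exists (e2 - e1); [|rewrite /line_edge -ef].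
by exists (f2 - f1); [|rewrite /line_edge -ef; exact: setUC].
Qed.

End OneApartment.

Lemma shared_edges w1 w2 x1 x2 :
    basis_of fullv [:: w1; w2] -> basis_of fullv [:: x1; x2] ->
  edges (apartment w1 w2) `&` edges (apartment x1 x2) =
  line_edge w1 w2 @` [set n | range (vertex x1 x2) (vertex w1 w2 n) /\
                              range (vertex x1 x2) (vertex w1 w2 (n + 1))].
Proof.
move=> w_basis x_basis; apply/seteqP; split=> E.
  rewrite (edges_apartment w_basis) => -[[n _ <-]].
  rewrite /apartment/= -/(on_apartment x1 x2) (on_apartmentE x_basis) => -[_ sub].
  by exists n => //; split; apply: sub; [left|right].
move=> [n [h1 h2] <-]; split; first by rewrite (edges_apartment w_basis); exists n.
rewrite /apartment/= -/(on_apartment x1 x2) (on_apartmentE x_basis).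
by split; [exact: building_line_edge|move=> v [->|->]].
Qed.

End Lattices.

(** * The integers indexing the shared vertices *)

(** The system of [shared_index] below when the four minors are nonzero, in
    terms of their valuations [vP], [vQ], [vR], [vS] and of the valuations
    [a] and [b] of the two determinants. *)
Definition shared_int (vP vQ vR vS a b n : int) : Prop := exists m k : int,
  [/\ k + a <= vS, k + n + a <= vP, k - m + a <= vR & k + n - m + a <= vQ] /\
  [/\ - k + b <= vQ, m - k + b <= vP, - (k + n) + b <= vR
    & m - (k + n) + b <= vS].

(** The hypotheses say that the least of [a + b], [vP + vR] and [vQ + vS] is
    attained twice. *)
Lemma shared_interval (vP vQ vR vS a b : int) :
    (a + b <= vP + vR) || (vQ + vS <= vP + vR) ->
    (a + b <= vQ + vS) || (vP + vR <= vQ + vS) ->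
    (vP + vR <= a + b) || (vQ + vS <= a + b) ->
  exists lo : int, forall n : int,
    shared_int vP vQ vR vS a b n /\ shared_int vP vQ vR vS a b (n + 1) <->
    lo <= n < lo + (absz (vP - vQ + vR - vS)%R)%:Z.
Proof.
move=> h1 h2 h3.
have [lt|le] := ltP (vQ + vS) (vP + vR).
  (* Here [a + b = vQ + vS], which forces [k = vS - a] and [m = vS - vQ + n];
     what remains is [vQ - vR <= n <= vP - vS]. *)
  exists (vQ - vR) => n; split.
    move=> [[m [k [[h4 h5 h6 h7] [h8 h9 h10 h11]]]]].
    by move=> [m' [k' [[g4 g5 g6 g7] [g8 g9 g10 g11]]]]; lia.
  move=> h; split; [exists (vS - vQ + n)|exists (vS - vQ + (n + 1))];
  by exists (vS - a); split; split; lia.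
(* If [vP + vR < vQ + vS], then [a + b = vP + vR], which forces
   [k = vP - a - n] and [m = vP - vR - n]; what remains is
   [vP - vS <= n <= vQ - vR].  If the two sums are equal, the interval is
   empty and at most one index is shared. *)
exists (vP - vS) => n; split.
  move=> [[m [k [[h4 h5 h6 h7] [h8 h9 h10 h11]]]]].
  by move=> [m' [k' [[g4 g5 g6 g7] [g8 g9 g10 g11]]]]; lia.
move=> h; split; [exists (vP - vR - n)|exists (vP - vR - (n + 1))];
  [exists (vP - a - n)|exists (vP - a - (n + 1))]; by split; split; lia.
Qed.

Section SharedIndices.
Variables (p : nat) (p_pr : prime p).
Local Notation Qp := (padic_num p_pr).
Variables (P Q R S D E : Qp).
Hypotheses (D0 : D != 0) (E0 : E != 0) (PQRS : P * R - Q * S = D * E).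

(** The condition for the vertex of index [n] of one apartment to be the vertex
    of index [m] of another one, for some [m]; [shared_vertexP] gives the
    meaning of the parameters.  The integer [k] is the valuation of the
    homothety.  The first four bounds express one inclusion of lattices, the
    last four the reverse one. *)
Definition shared_index (n : int) : Prop := exists m k : int,
  [/\ val_ge (k + valz D) S, val_ge (k + n + valz D) P,
      val_ge (k - m + valz D) R & val_ge (k + n - m + valz D) Q] /\
  [/\ val_ge (- k + valz E) Q, val_ge (m - k + valz E) P,
      val_ge (- (k + n) + valz E) R & val_ge (m - (k + n) + valz E) S].

Lemma shared_index_interval : P != 0 -> Q != 0 -> R != 0 -> S != 0 ->
  exists lo : int, forall n : int, shared_index n /\ shared_index (n + 1) <->
    lo <= n < lo + (absz (valz P - valz Q + valz R - valz S)%R)%:Z.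
Proof.
move=> P0 Q0 R0 S0.
have PR0 : P * R != 0 := mulf_neq0 P0 R0.
have QS0 : Q * S != 0 := mulf_neq0 Q0 S0.
have DE0 : D * E != 0 := mulf_neq0 D0 E0.
have h1 := valz_sub_min PR0 QS0 DE0 PQRS.
have PQRS2 : P * R - D * E = Q * S by rewrite -PQRS subKr.
have h2 := valz_sub_min PR0 DE0 QS0 PQRS2.
have PQRS3 : Q * S - - (D * E) = P * R by rewrite opprK -PQRS addrC subrK.
have nDE0 : - (D * E) != 0 by rewrite oppr_eq0 DE0.
have h3 := valz_sub_min QS0 nDE0 PR0 PQRS3.
move: h1 h2 h3; rewrite valzN.
rewrite (valzM P0 R0) (valzM Q0 S0) (valzM D0 E0) => h1 h2 h3.
have sE n : shared_index n <->
    shared_int (valz P) (valz Q) (valz R) (valz S) (valz D) (valz E) n.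
  by split=> -[m [k h]]; exists m, k; move: h;
    rewrite !(val_ge_neq0 _ P0) !(val_ge_neq0 _ Q0) !(val_ge_neq0 _ R0)
      !(val_ge_neq0 _ S0).
have [lo loP] : exists lo : int, forall n : int,
    shared_int (valz P) (valz Q) (valz R) (valz S) (valz D) (valz E) n /\
    shared_int (valz P) (valz Q) (valz R) (valz S) (valz D) (valz E) (n + 1) <->
    lo <= n < lo + (absz (valz P - valz Q + valz R - valz S)%R)%:Z.
  by apply: shared_interval; rewrite // orbC.
by exists lo => n; rewrite !sE.
Qed.

(** When [PR] vanishes, [QS] has the valuation of [DE], and two bounds, on [P]
    and on [R], suffice.  [shared_index_PR] is the case where [QS] vanishes. *)
Lemma shared_index_QS (n : int) : valz Q + valz S = valz D + valz E ->
  val_ge (valz S + n) P -> val_ge (valz Q - n) R -> shared_index n.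
Proof.
move=> e hP hR.
have hQ k : k = valz Q -> val_ge k Q by move=> ->; rewrite /val_ge lexx orbT.
have hS k : k = valz S -> val_ge k S by move=> ->; rewrite /val_ge lexx orbT.
have hP' k : k = valz S + n -> val_ge k P by move=> ->.
have hR' k : k = valz Q - n -> val_ge k R by move=> ->.
exists (valz S - valz Q + n), (valz S - valz D).
move: (valz Q) (valz S) (valz D) (valz E) e hQ hS hP' hR' {hP hR}.
move=> vQ vS a b e hQ hS hP hR; split; split.
- by apply: hS; lia.
- by apply: hP; lia.
- by apply: hR; lia.
- by apply: hQ; lia.
- by apply: hQ; lia.
- by apply: hP; lia.
- by apply: hR; lia.
- by apply: hS; lia.
Qed.

Lemma shared_index_PR (n : int) : valz P + valz R = valz D + valz E ->
  val_ge (valz P - n) S -> val_ge (valz R + n) Q -> shared_index n.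
Proof.
move=> e hS hQ.
have hP k : k = valz P -> val_ge k P by move=> ->; rewrite /val_ge lexx orbT.
have hR k : k = valz R -> val_ge k R by move=> ->; rewrite /val_ge lexx orbT.
have hS' k : k = valz P - n -> val_ge k S by move=> ->.
have hQ' k : k = valz R + n -> val_ge k Q by move=> ->.
exists (valz P - valz R - n), (valz P - valz D - n).
move: (valz P) (valz R) (valz D) (valz E) e hP hR hS' hQ' {hS hQ}.
move=> vP vR a b e hP hR hS hQ; split; split.
- by apply: hS; lia.
- by apply: hP; lia.
- by apply: hR; lia.
- by apply: hQ; lia.
- by apply: hQ; lia.
- by apply: hP; lia.
- by apply: hR; lia.
- by apply: hS; lia.
Qed.

Let valz_QS : P * R = 0 -> valz Q + valz S = valz D + valz E.
Proof.
move=> PR0; have QSE : - (Q * S) = D * E by rewrite -PQRS PR0 sub0r.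
have : Q * S != 0 by rewrite -oppr_eq0 QSE (mulf_neq0 D0 E0).
rewrite mulf_eq0 negb_or => /andP[Q0 S0].
by rewrite -(valzM D0 E0) -QSE valzN (valzM Q0 S0).
Qed.

Let valz_PR : Q * S = 0 -> valz P + valz R = valz D + valz E.
Proof.
move=> QS0; have PRE : P * R = D * E by rewrite -PQRS QS0 subr0.
have : P * R != 0 by rewrite PRE (mulf_neq0 D0 E0).
rewrite mulf_eq0 negb_or => /andP[P0 R0].
by rewrite -(valzM D0 E0) -PRE (valzM P0 R0).
Qed.

Lemma shared_index_half_line : [|| P == 0, Q == 0, R == 0 | S == 0] ->
  exists N : int, (forall i : nat, shared_index (N + i%:Z)) \/
                  (forall i : nat, shared_index (N - i%:Z)).
Proof.
have val_ge_zero k (x : Qp) : x = 0 -> val_ge k x.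
  by move=> ->; rewrite /val_ge eqxx.
have val_ge_le k (x : Qp) : k <= valz x -> val_ge k x.
  by rewrite /val_ge orbC => ->.
(* In each case the bound on the vanishing minor holds for free, and the other
   one bounds [n] on one side only. *)
move=> /or4P[] /eqP x0.
- have e : P * R = 0 by rewrite x0 mul0r.
  exists (valz Q - valz R); left=> i; apply: (shared_index_QS (valz_QS e)).
    exact: val_ge_zero.
  by apply: val_ge_le; move: (valz Q) (valz R) => vQ vR; lia.
- have e : Q * S = 0 by rewrite x0 mul0r.
  exists (valz P - valz S); left=> i; apply: (shared_index_PR (valz_PR e)).
    by apply: val_ge_le; move: (valz P) (valz S) => vP vS; lia.
  exact: val_ge_zero.
- have e : P * R = 0 by rewrite x0 mulr0.
  exists (valz P - valz S); right=> i; apply: (shared_index_QS (valz_QS e)).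
    by apply: val_ge_le; move: (valz P) (valz S) => vP vS; lia.
  exact: val_ge_zero.
- have e : Q * S = 0 by rewrite x0 mulr0.
  exists (valz Q - valz R); right=> i; apply: (shared_index_PR (valz_PR e)).
    exact: val_ge_zero.
  by apply: val_ge_le; move: (valz Q) (valz R) => vQ vR; lia.
Qed.

End SharedIndices.

(** * Counting the shared edges *)

Lemma ecard_image_interval (T : choiceType) (f : int -> T) (lo : int) (N : nat) :
  injective f ->
  ecard (f @` [set n | lo <= n < lo + N%:Z]) = (N%:Z)%:E.
Proof.
move=> f_inj; have -> : f @` [set n | lo <= n < lo + N%:Z] =
    (fun i : nat => f (lo + i%:Z)) @` `I_N.
  apply/seteqP; split=> _ [n /= nN <-].
    by exists `|n - lo|%N; [rewrite /=; lia|congr f; lia].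
  by exists (lo + n%:Z); [rewrite /=; lia|].
have cN : ((fun i : nat => f (lo + i%:Z)) @` `I_N #= `I_N)%card.
  by apply: inj_card_eq => i j _ _ /f_inj; lia.
rewrite /ecard; case: pselect => [fin|[]]; last by exists N.
by rewrite (card_fset_set cN).
Qed.

Lemma ecard_infinite (T : choiceType) (A : set T) (g : nat -> T) :
  injective g -> (forall i, A (g i)) -> ecard A = +oo%E.
Proof.
move=> g_inj Ag; rewrite /ecard; case: pselect => // finA; exfalso.
apply: infinite_nat; have -> : [set: nat] = g @^-1` A.
  by apply/seteqP; split=> i // _; exact: Ag.
by apply: finite_preimage finA => i j _ _ /g_inj.
Qed.

Section TwoApartments.
Variables (p : nat) (p_pr : prime p).
Local Notation Qp := (padic_num p_pr).
Local Notation V := 'rV[Qp]_2.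

(** [P], [Q], [R], [S] are, up to sign, the numerators of the coordinates of
    each basis in the other one, with the denominators [D] and [E]. *)
Lemma shared_vertexP (w1 w2 x1 x2 : V) (P Q R S D E : Qp) n :
    basis_of fullv [:: w1; w2] -> basis_of fullv [:: x1; x2] ->
    D != 0 -> E != 0 ->
    D *: x1 = - S *: w1 + P *: w2 -> D *: x2 = - R *: w1 + Q *: w2 ->
    E *: w1 = Q *: x1 + - P *: x2 -> E *: w2 = R *: x1 + - S *: x2 ->
  range (vertex x1 x2) (vertex w1 w2 n) <-> shared_index P Q R S D E n.
Proof.
move=> w_basis x_basis D0 E0 x1E x2E w1E w2E.
have eqE m k : diag_lattice w1 w2 k (k + n) = diag_lattice x1 x2 0 m <->
    [/\ val_ge (k + valz D) S, val_ge (k + n + valz D) P,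
        val_ge (k - m + valz D) R & val_ge (k + n - m + valz D) Q] /\
    [/\ val_ge (- k + valz E) Q, val_ge (m - k + valz E) P,
        val_ge (- (k + n) + valz E) R & val_ge (m - (k + n) + valz E) S].
  have := diag_lattice_sub_frac k (k + n) 0 m w_basis x_basis E0 w1E w2E.
  have := diag_lattice_sub_frac 0 m k (k + n) x_basis w_basis D0 x1E x2E.
  rewrite !subr0 !sub0r !val_geN => xw wx; rewrite eqEsubset.
  split; first by move=> [/wx ? /xw].
  by move=> [/xw ? /wx].
split=> [[m _ /esym/homothety_classP[q q0]]|[m [k /eqE h]]].
  rewrite (dilate_diag_lattice w_basis _ _ q0) add0r addrC => /esym /eqE h.
  by exists m, (valz q); exact: h.
exists m; first by [].
by rewrite /vertex -h (vertex_diag_lattice w_basis) addrAC subrr add0r.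
Qed.

Lemma ecard_shared_index (T : choiceType) (g : int -> T) (P Q R S D E : Qp) :
    D != 0 -> E != 0 -> P * R - Q * S = D * E -> injective g ->
  ecard (g @` [set n | shared_index P Q R S D E n /\
                       shared_index P Q R S D E (n + 1)]) =
  (`| padic_val P - padic_val Q + padic_val R - padic_val S |)%E.
Proof.
move=> D0 E0 PQRS g_inj; set J := [set n | _].
have inf : [|| P == 0, Q == 0, R == 0 | S == 0] -> ecard (g @` J) = +oo%E.
  move=> /(shared_index_half_line D0 E0 PQRS)[N [hN|hN]].
    apply: (@ecard_infinite _ _ (fun i : nat => g (N + i%:Z))).
      by move=> i j /g_inj; lia.
    move=> i; exists (N + i%:Z); [split|by []]; first exact: hN.
    by have -> : N + i%:Z + 1 = N + i.+1%:Z by lia.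
  apply: (@ecard_infinite _ _ (fun i : nat => g (N - i.+1%:Z))).
    by move=> i j /g_inj; lia.
  move=> i; exists (N - i.+1%:Z); [split|by []]; first exact: hN.
  by have -> : N - i.+1%:Z + 1 = N - i%:Z by lia.
case: (boolP [|| P == 0, Q == 0, R == 0 | S == 0]) => z; last first.
  move: z; rewrite !negb_or => /and4P[P0 Q0 R0 S0].
  have [lo loP] := shared_index_interval D0 E0 PQRS P0 Q0 R0 S0.
  rewrite (padic_valE P0) (padic_valE Q0) (padic_valE R0) (padic_valE S0).
  have -> : J =
      [set n | lo <= n < lo + (absz (valz P - valz Q + valz R - valz S)%R)%:Z].
    by apply/seteqP; split=> n /loP.
  by rewrite (ecard_image_interval _ _ g_inj).
(* An infinite term makes the alternating sum infinite, whatever the other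
   three are. *)
rewrite (inf z); move: z.
have val_cases (x : Qp) : (x == 0 /\ padic_val x = +oo%E) \/
    (x != 0 /\ padic_val x = (valz x)%:E).
  have [->|x0] := eqVneq x 0; [left|right]; first by rewrite padic_val0.
  by rewrite padic_valE.
have [[-> ->]|[/negPf -> ->]] := val_cases P;
have [[-> ->]|[/negPf -> ->]] := val_cases Q;
have [[-> ->]|[/negPf -> ->]] := val_cases R;
by have [[-> ->]|[/negPf -> ->]] := val_cases S.
Qed.

Lemma ecard_shared_edges (u1 u2 : V) (c d e f r s t u : Qp) :
    basis_of fullv [:: u1; u2] -> c * f - d * e != 0 -> r * u - s * t != 0 ->
  ecard (edges (apartment (c *: u1 + d *: u2) (e *: u1 + f *: u2)) `&`
         edges (apartment (r *: u1 + s *: u2) (t *: u1 + u *: u2))) =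
  (`| padic_val (c * s - d * r)%R - padic_val (c * u - d * t)%R
      + padic_val (e * u - f * t)%R - padic_val (e * s - f * r)%R |)%E.
Proof.
move=> u_basis D0 E0.
have w_basis := basis2_change u_basis D0; have x_basis := basis2_change u_basis E0.
have sE n := shared_vertexP n w_basis x_basis D0 E0
  (cramer2 u1 u2 c d e f r s) (cramer2 u1 u2 c d e f t u)
  (cramer2_dual u1 u2 c d r s t u) (cramer2_dual u1 u2 e f r s t u).
rewrite (shared_edges w_basis x_basis).
rewrite -(ecard_shared_index D0 E0 (plucker2 c d e f r s t u) (line_edge_inj w_basis)).
congr (ecard (_ @` _)).
by apply/seteqP; split=> n [/sE h1 /sE h2]; split.
Qed.

End TwoApartments.

Lemma det_mx2 (p : nat) (p_pr : prime p) (a b c d : padic_num p_pr) :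
  \det (mx2 a b c d) = a * d - b * c.
Proof.
rewrite (expand_det_row _ ord0) !big_ord_recl big_ord0 /cofactor !det_mx11 !mxE/=.
by rewrite !mul1r addr0 expr1 mulN1r mulrN.
Qed.

Theorem theorem40 (p : nat) (p_pr : prime p)
    (F : 2.-tuple 'rV[padic_num p_pr]_2) (F_basis : basis_of fullv F)
    (c d e f r s t u : padic_num p_pr)
    (A'_unit : mx2 c d e f \in unitmx) (A''_unit : mx2 r s t u \in unitmx) :
  ecard (edges (mx_apartment F (mx2 c d e f)) `&`
               edges (mx_apartment F (mx2 r s t u)))
  = (`| det_val (mx2 c d r s) - det_val (mx2 c d t u)
        + det_val (mx2 e f t u) - det_val (mx2 e f r s) |)%E.
Proof.
case: F F_basis => -[|u1 [|u2 [|]]]//= F_size F_basis.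
rewrite /mx_apartment !mxE/= /det_val !det_mx2.
move: A'_unit A''_unit; rewrite !unitmxE !det_mx2 !unitfE.
exact: ecard_shared_edges.
Qed.
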